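(* Let $\alpha\in[0,1]$. Let $G_1$ be a $t_1$-regular graph of order $n_1$ and size $m_1$, and let $G_2$ be a $t_2$-regular graph of order $n_2$. (a) When $t_1=1$, the $A_\alpha$-spectrum of $G_1\dot\vee_Q G_2$ comprises: (i) one simple eigenvalue $\alpha(1+n_2)$; (ii) the eigenvalues $2\alpha+\lambda_j(A_\alpha(G_2))$ for $j=2,3,\ldots,n_2$; and (iii) three eigenvalues obtained by solving $$(\nu-2\alpha -t_2)(\nu-\alpha -\alpha n_2)(\nu-2\alpha)-2n_2(1-\alpha)^2(\nu-2\alpha) - 2(1-\alpha)^2(\nu-2\alpha -t_2)=0.$$ (b) When $t_1\ge 2$, the $A_\alpha$-spectrum of $G_1\dot\vee_Q G_2$ comprises: (i) one eigenvalue $2\alpha(1+t_1)-2$ with multiplicity $m_1-n_1$; (ii) the eigenvalues $\alpha n_1+\lambda_j(A_\alpha(G_2))$ for $j=2,3,\ldots,n_2$; (iii) the eigenvalues obtained by solving, for each $i=2,3,\ldots,n_1$, the equation $$\nu^2 -\big(t_1 -2 +\lambda_i(A_{\alpha}(G_1))+\alpha(2+t_1 +n_2)\big)\nu-2\alpha (1-\alpha)n_2 -\big(1-\alpha(1+t_1 +n_2)\big) \big(t_1 +\lambda_i(A_{\alpha}(G_1))\big) = 0;$$ and (iv) three eigenvalues obtained by solving the equation $$(\nu-\alpha n_1 -t_2)(\nu-\alpha t_1 -\alpha n_2)(\nu+2-2\alpha -2t_1) -n_1 n_2 (1-\alpha)^2(\nu+2-2\alpha -2t_1) -2(1-\alpha)^2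 t_1(\nu-\alpha n_1 -t_2)=0.$$
   Context: All graphs are undirected and simple. For a graph $G$ with adjacency matrix $A(G)$ and diagonal degree matrix $D(G)$, put $A_\alpha(G)=\alpha D(G)+(1-\alpha)A(G)$. The $A_\alpha$-spectrum of $G$ is the multiset of eigenvalues of $A_\alpha(G)$. Eigenvalues of a symmetric $n\times n$ matrix $M$ are ordered $\lambda_1(M)\ge\cdots\ge\lambda_n(M)$. The order of a graph is its number of vertices and its size is its number of edges. The $Q$-graph $\mathcal Q(G)$ is obtained from $G$ by inserting a new vertex into each edge of $G$ (so each edge is subdivided: the new vertex is adjacent to the two ends of the edge, and the original edge is no longer present), and then making two new vertices adjacent whenever they lie on adjacent edges of $G$ (distinct edges sharing an endpoint). The $Q$-vertex join $G_1\dot\vee_Q G_2$ is obtained from the disjoint union of $\mathcal Q(G_1)$ and $G_2$ by joining each original vertex of $G_1$ in $\mathcal Q(G_1)$ to every vertex of $G_2$.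
   Formalization: Part (a) is proved for n_1=2 (G_1=K_2), since for t_1=1 and any other n_1 the listed n_2+3 eigenvalues are fewer than the 3n_1/2+n_2 vertices; ''simple'' means listed once, as it may coincide with other listed eigenvalues; both graphs are nonempty. *)

(* Defs.v *)
From HB Require Import structures.
From mathcomp Require Import all_boot all_order all_algebra.
From mathcomp Require Export polyrcf.

Set Implicit Arguments.
Unset Strict Implicit.
Unset Printing Implicit Defensive.

Import Order.TTheory GRing.Theory Num.Theory.
Local Open Scope ring_scope.

Record sgraph := SGraph {
  vertex :> finType;
  adj : rel vertex;
  adj_sym : symmetric adj;
  adj_irrefl : irreflexive adj }.

Section Graphs.
Variable G : sgraph.

Definition gorder : nat := #|G|.

Definition edges : {set {set G}} :=
  [set [set p.1; p.2] | p : G * G & adj p.1 p.2].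

Definition gsize : nat := #|edges|.

Definition edge : finType := {f : {set G} | f \in edges}.

Definition deg (x : G) : nat := #|[set y | adj x y]|.

Definition regular (t : nat) : Prop := forall x : G, deg x = t.

Definition Qadj (u v : (G + edge)%type) : bool :=
  match u, v with
  | inl _, inl _ => false
  | inl x, inr f => x \in val f
  | inr f, inl x => x \in val f
  | inr f, inr g => (f != g) && (val f :&: val g != set0)
  end.

Lemma Qadj_sym : symmetric Qadj.
Proof. by move=> [x|f] [y|g] //=; rewrite eq_sym setIC. Qed.

Lemma Qadj_irrefl : irreflexive Qadj.
Proof. by move=> [x|f] //=; rewrite eqxx. Qed.

Definition Qgraph : sgraph := SGraph Qadj_sym Qadj_irrefl.

End Graphs.

Section Join.
Variables G1 G2 : sgraph.

Definition orig_vertex (u : Qgraph G1) : bool :=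
  if u is inl _ then true else false.

Definition Qjoin_adj (u v : (Qgraph G1 + G2)%type) : bool :=
  match u, v with
  | inl a, inl b => adj a b
  | inr y, inr z => adj y z
  | inl a, inr _ => orig_vertex a
  | inr _, inl b => orig_vertex b
  end.

Lemma Qjoin_sym : symmetric Qjoin_adj.
Proof. by move=> [a|y] [b|z] //; apply: (@adj_sym _ _ _). Qed.

Lemma Qjoin_irrefl : irreflexive Qjoin_adj.
Proof. by move=> [a|y]; apply: adj_irrefl. Qed.

Definition Qvertex_join : sgraph := SGraph Qjoin_sym Qjoin_irrefl.

End Join.

Section Matrices.
Variables (R : rcfType) (G : sgraph).

(* Rows and columns are indexed by the enumeration of the vertex type. *)
Definition adj_mx : 'M[R]_(gorder G) :=
  \matrix_(i, j) (adj (enum_val i) (enum_val j))%:R.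

Definition deg_mx : 'M[R]_(gorder G) :=
  diag_mx (\row_i (deg (enum_val i))%:R).

Definition Aalpha (alpha : R) : 'M[R]_(gorder G) :=
  alpha *: deg_mx + (1 - alpha) *: adj_mx.

End Matrices.

Section Spectrum.
Variable R : rcfType.

(* The multiset of roots in R of p, with multiplicity, as a list; it is meant
   for nonzero p (rootsR lists the distinct roots of p, and is empty at 0). *)
Definition mroots (p : {poly R}) : seq R :=
  flatten [seq nseq (mup x p) x | x <- rootsR p].

(* The eigenvalues lying in R, with algebraic multiplicity, in nonincreasing
   order. For a symmetric matrix of order n these are all n eigenvalues. *)
Definition spectrum n (M : 'M[R]_n) : seq R :=
  sort >=%R (mroots (char_poly M)).

(* The index j starts from 1: eigval 1 M is the largest eigenvalue. *)
Definition eigval (j : nat) n (M : 'M[R]_n) : R := (spectrum M)`_(j.-1).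

End Spectrum.

(* Main.v *)
Require Import Defs.
From mathcomp Require Import all_boot all_order all_fingroup all_algebra.
From mathcomp Require Import spectral complex ring lra zify.

(* Put c = 1 - alpha and let B be the vertex-edge incidence matrix of G1, so
   that c B B^T = A_alpha(G1) + t1 (1 - 2 alpha) I and the edge-edge block of
   x I - A_alpha(join) is b I - c B^T B.  Subtracting B^T times the vertex rows
   from the edge rows makes this block scalar; its Schur complement is
   [P, u J; v J^T, D] with P a polynomial in A_alpha(G1), D = x - alpha n1 -
   A_alpha(G2) and J all-ones.  As P and D have constant row sums, its
   determinant is explicit in det P and det D.  This evaluates the
   characteristic polynomial at all but finitely many x, hence everywhere.
   Its factors split because a real symmetric matrix has a split
   characteristic polynomial, and lambda_1 = t because all entries of A_alpha
   are nonnegative and its rows sum to t. *)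

Set Implicit Arguments.
Unset Strict Implicit.
Unset Printing Implicit Defensive.

Import Order.TTheory GRing.Theory Num.Theory.
Local Open Scope ring_scope.

(** * Multisets of roots of polynomials *)

Section RootMultiset.
Variable R : rcfType.
Implicit Types (p q : {poly R}) (s : seq R).

Lemma count_mroots p x : p != 0 -> count_mem x (mroots p) = mup x p.
Proof.
move=> p0; rewrite count_flatten -map_comp.
have -> : [seq (count_mem x \o (fun y => nseq (mup y p) y)) y | y <- rootsR p]
  = [seq (if y == x then mup x p else 0)%N | y <- rootsR p].
  by apply: eq_map => y /=; rewrite count_nseq /=;
    have [->|_] := eqVneq y x; rewrite ?mul1n ?mul0n.
rewrite sumnE big_map -big_mkcond /= big_const_seq iter_addn_0.
rewrite count_uniq_mem; last exact: polyrcf.uniq_roots.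
have := roots_on_rootsR p0 => /(_ x); rewrite in_itv /= => <-.
by case rpx : (root p x); rewrite ?muln1 // muln0 mupNroot ?rpx.
Qed.

Lemma mrootsM p q : p * q != 0 ->
  perm_eq (mroots (p * q)) (mroots p ++ mroots q).
Proof.
move=> pq0; have [p0 q0] : p != 0 /\ q != 0.
  by split; apply: contraNneq pq0 => ->; rewrite ?mul0r ?mulr0.
by apply/allP => x _ /=; rewrite count_cat !count_mroots ?mupM.
Qed.

Lemma mroots_prod_XsubC s : perm_eq (mroots (\prod_(x <- s) ('X - x%:P))) s.
Proof.
apply/allP => x _ /=.
by rewrite count_mroots ?mu_prod_XsubC // monic_neq0 // monic_prod_XsubC.
Qed.

Lemma mroots_prod (I : Type) (r : seq I) (F : I -> {poly R}) :
  \prod_(i <- r) F i != 0 ->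
  perm_eq (mroots (\prod_(i <- r) F i)) (flatten [seq mroots (F i) | i <- r]).
Proof.
elim: r => [|i r IHr]; first by have := mroots_prod_XsubC [::]; rewrite !big_nil.
rewrite big_cons => nz; apply: perm_trans (mrootsM nz) _.
rewrite /= perm_cat2l IHr //; apply: contraNneq nz => ->; by rewrite mulr0.
Qed.

(** A monic divisor of a product of linear factors is the product over a sublist of them, so
    [mroots] loses no root. *)
Lemma mroots_split p s : p \is monic -> p %| \prod_(x <- s) ('X - x%:P) ->
  \prod_(x <- mroots p) ('X - x%:P) = p.
Proof.
move=> mp /dvdp_prod_XsubC[m]; rewrite eqp_monic ?monic_prod_XsubC // => /eqP ->.
exact: perm_big (mroots_prod_XsubC _).
Qed.

Lemma size_mroots_split p s : p \is monic -> p %| \prod_(x <- s) ('X - x%:P) ->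
  size (mroots p) = (size p).-1.
Proof. by move=> mp /(mroots_split mp){2}<-; rewrite size_prod_XsubC. Qed.

(** [d * (p - q)] vanishes at every point, and the field is infinite. This allows dividing by any
    value that is nonzero whenever [d.[x]] is. *)
Lemma poly_eq_generic p q d : d != 0 ->
  (forall x, d.[x] != 0 -> p.[x] = q.[x]) -> p = q.
Proof.
move=> d0 eq_pq; apply/eqP; rewrite -subr_eq0; apply: contraT => pq0.
have nz : d * (p - q) != 0 by rewrite mulf_neq0.
(* As many distinct roots as the size of the polynomial is one more than its degree; in
   characteristic 0 the naturals provide them. *)
have := @max_poly_roots _ _ [seq k%:R | k <- iota 0 (size (d * (p - q)))] nz.
rewrite size_map size_iota ltnn; apply.
  apply/allP => x _; rewrite /root hornerM hornerD hornerN.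
  by have [->|/eq_pq ->] := eqVneq d.[x] 0; rewrite ?mul0r // subrr mulr0.
by rewrite map_inj_uniq ?iota_uniq //; apply: mulrIn; rewrite oner_eq0.
Qed.

End RootMultiset.

(** * Real symmetric matrices: split characteristic polynomial and constant row sums *)

Section SymmetricMatrices.

Lemma char_poly_conj (F : fieldType) n (P A : 'M[F]_n) : P \in unitmx ->
  char_poly (invmx P *m A *m P) = char_poly A.
Proof.
move=> Pu; have Pu' : map_mx polyC (invmx P) *m map_mx polyC P = 1%:M.
  by rewrite -map_mxM mulVmx // map_mx1.
rewrite /char_poly /char_poly_mx -[RHS]mul1r -[1 in RHS](det1 _ n) -Pu' det_mulmx.
rewrite [in RHS]mulrAC -!det_mulmx mulmxBr mulmxBl !map_mxM.
by rewrite mul_mx_scalar -scalemxAl Pu' scalemx1.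
Qed.

Variable R : rcfType.

(** Over [R[i]] the matrix is Hermitian, hence unitarily diagonalizable with real eigenvalues. The
    resulting factorization descends because the embedding of [R] is injective on polynomials. *)
Lemma char_poly_sym_split n (A : 'M[R]_n) : A^T = A ->
  exists s : seq R, char_poly A = \prod_(x <- s) ('X - x%:P).
Proof.
move=> symA; pose f := real_complex R; pose AC := map_mx f A.
have AC_herm : AC \is hermsymmx.
  apply: realsym_hermsym.
    apply/is_hermitianmxP; rewrite expr0 scale1r map_mx_id //.
    by apply/matrixP => i j; rewrite !mxE -[in RHS]symA mxE.
  by apply/mxOverP => i j; rewrite mxE; apply/complex_realP; exists (A i j).
have /hermitian_normalmx/orthomx_spectralP defA := AC_herm.
have /mxOverP Dreal := hermitian_spectral_diag_real AC_herm.
exists [seq complex.Re (spectral_diag AC 0 i) | i <- enum 'I_n].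
apply: (map_inj_poly (@complexI R) (erefl _)).
rewrite -/f map_char_poly -/AC defA char_poly_conj ?spectral_unit //.
rewrite char_poly_trig ?diag_mx_is_trig //.
rewrite rmorph_prod big_map big_enum; apply: eq_bigr => i _.
rewrite rmorphB /= map_polyX map_polyC /= mxE eqxx mulr1n.
by rewrite -defA RRe_real.
Qed.


Lemma prod_spectrum n (A : 'M[R]_n) : A^T = A ->
  \prod_(x <- spectrum A) ('X - x%:P) = char_poly A.
Proof.
move=> /char_poly_sym_split[s defs].
rewrite (perm_big (mroots (char_poly A))) /=; last by rewrite perm_sort.
by apply: (@mroots_split _ _ s); rewrite ?char_poly_monic // defs.
Qed.

Lemma size_spectrum n (A : 'M[R]_n) : A^T = A -> size (spectrum A) = n.
Proof.
move=> symA; apply: succn_inj.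
by rewrite -(size_char_poly A) -prod_spectrum // size_prod_XsubC.
Qed.

Lemma mem_spectrum n (A : 'M[R]_n) x : A^T = A ->
  (x \in spectrum A) = eigenvalue A x.
Proof.
by move=> symA; rewrite eigenvalue_root_char -prod_spectrum // root_prod_XsubC.
Qed.

Lemma rowsum_eigenvalue n (A : 'M[R]_n) (t : R) : (0 < n)%N -> A^T = A ->
  (forall i, \sum_j A i j = t) -> eigenvalue A t.
Proof.
move=> n0 symA rowA; apply/eigenvalueP; exists (const_mx 1).
  apply/rowP => j; rewrite !mxE mulr1 -(rowA j).
  by apply: eq_bigr => i _; rewrite mxE mul1r -[in RHS]symA mxE.
apply/eqP => /rowP/(_ (Ordinal n0))/eqP.
by rewrite !mxE oner_eq0.
Qed.

(** At a coordinate [i] where [|v 0 i|] is largest, the triangle inequality bounds [|x * v 0 i|] by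
    [t * |v 0 i|]. *)
Lemma eigenvalue_le_rowsum n (A : 'M[R]_n) (t x : R) : A^T = A ->
  (forall i j, 0 <= A i j) -> (forall i, \sum_j A i j = t) ->
  eigenvalue A x -> x <= t.
Proof.
move=> symA A0 rowA /eigenvalueP[v /rowP vA /rV0Pn[i0 vi0]].
case: (@arg_maxP _ _ _ i0 xpredT (fun i => `|v 0 i|)) => // i _ imax.
have vi : 0 < `|v 0 i| by apply: lt_le_trans (imax i0 isT); rewrite normr_gt0.
rewrite -(ler_pM2r vi); apply: le_trans (_ : `|x * v 0 i| <= _).
  by rewrite normrM ler_wpM2r // ler_norm.
have := vA i; rewrite !mxE => <-; apply: le_trans (ler_norm_sum _ _ _) _.
rewrite -(rowA i) mulr_suml; apply: ler_sum => j _.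
rewrite normrM mulrC -[in A j i]symA mxE ger0_norm //.
by apply: ler_wpM2l => //; apply: imax.
Qed.

Lemma spectrum_rowsum n (A : 'M[R]_n) (t : R) : (0 < n)%N -> A^T = A ->
  (forall i j, 0 <= A i j) -> (forall i, \sum_j A i j = t) ->
  spectrum A = t :: [seq eigval j A | j <- index_iota 2 n.+1].
Proof.
move=> n0 symA A0 rowA; have szA := size_spectrum symA.
have t_in : t \in spectrum A by rewrite mem_spectrum // rowsum_eigenvalue.
have le_t x : x \in spectrum A -> x <= t.
  by rewrite mem_spectrum //; apply: eigenvalue_le_rowsum.
have : sorted >=%R (spectrum A) by apply: sort_sorted => x y; apply: le_total.
(* [eigval j] reads position [j.-1], so the indices 2 to n run through the tail of the list. *)
have -> : [seq eigval j A | j <- index_iota 2 n.+1] = behead (spectrum A).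
  apply: (@eq_from_nth _ 0).
    by rewrite size_map size_iota size_behead szA subSS subn1.
  move=> i; rewrite size_map size_iota => lt_i.
  by rewrite (nth_map 0%N) ?size_iota // nth_iota // nth_behead.
case: (spectrum A) t_in le_t => // y s t_in le_t /= sorted_s.
congr (_ :: _); apply/le_anti; rewrite le_t ?mem_head //=.
move: t_in; rewrite inE => /orP[/eqP -> //|ts].
have ge_trans : transitive (>=%R : rel R) by move=> a b c ba cb; apply: le_trans ba.
by have /allP/(_ _ ts) := order_path_min ge_trans sorted_s.
Qed.

End SymmetricMatrices.

(** * Determinants of block matrices *)

Section Determinants.
Variable F : fieldType.

Lemma horner_char_poly n (A : 'M[F]_n) x : (char_poly A).[x] = \det (x%:M - A).
Proof.
rewrite -[LHS]/(horner_eval x (char_poly A)) -det_map_mx; congr (\det _).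
apply/matrixP => i j; rewrite !mxE /= /horner_eval hornerD hornerN hornerC.
by rewrite hornerMn hornerX.
Qed.

(** Block LU factorization; the last factor is the determinant of the Schur complement of the scalar
    block. *)
Lemma det_block_scalar m n (b : F) (Y : 'M_(m, n)) Z W : b != 0 ->
  \det (block_mx b%:M Y Z W) = b ^+ m * \det (W - b^-1 *: (Z *m Y)).
Proof.
move=> b0; have -> : block_mx b%:M Y Z W =
    block_mx b%:M 0 Z 1%:M *m block_mx 1%:M (b^-1 *: Y) 0 (W - b^-1 *: (Z *m Y)).
  rewrite mulmx_block !mulmx1 !mulmx0 !mul0mx !mul1mx !addr0 -!scalemxAr.
  by rewrite mul_scalar_mx scalerA mulVf // scale1r addrC subrK.
by rewrite det_mulmx det_lblock det_ublock det_scalar !det1 mulr1 mul1r.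
Qed.

(** Both sides are Schur complements of [block_mx 1%:M Y Z 1%:M], taken with respect to its two
    diagonal blocks. *)
Lemma det_1_subC m n (Y : 'M[F]_(m, n)) (Z : 'M_(n, m)) :
  \det (1%:M - Y *m Z) = \det (1%:M - Z *m Y).
Proof.
have := @det_block_scalar m n 1 Y Z 1%:M (oner_neq0 _).
rewrite expr1n mul1r invr1 scale1r => <-.
have -> : block_mx 1%:M Y Z 1%:M =
    block_mx (1%:M - Y *m Z) Y 0 1%:M *m block_mx 1%:M 0 Z 1%:M.
  by rewrite mulmx_block !mulmx1 !mulmx0 !mul1mx !add0r subrK.
by rewrite det_mulmx det_lblock det_ublock !det1 !mulr1.
Qed.

Lemma const_mx1_mul m n p :
  (const_mx 1 : 'M[F]_(m, n)) *m (const_mx 1 : 'M_(n, p)) = const_mx n%:R.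
Proof.
apply/matrixP => i j; rewrite !mxE (eq_bigr (fun _ => 1)).
  by rewrite sumr_const card_ord.
by move=> k _; rewrite !mxE mulr1.
Qed.

Lemma const_mxZ m n (u : F) : const_mx u = u *: const_mx 1 :> 'M_(m, n).
Proof. by apply/matrixP => i j; rewrite !mxE mulr1. Qed.

Lemma mulmx_const1 m n p (M : 'M[F]_(m, n)) (d : F) :
  (forall i, \sum_j M i j = d) -> M *m const_mx 1 = const_mx d :> 'M_(m, p).
Proof.
move=> rowM; apply/matrixP => i j; rewrite !mxE -(rowM i).
by apply: eq_bigr => k _; rewrite mxE mulr1.
Qed.

(** As [D] maps the all-ones vector to [d] times itself, the perturbation is [D] times a rank-one
    update of the identity, and [det_1_subC] reduces the latter to size 1. *)
Lemma det_sub_const n (D : 'M[F]_n) (d w : F) : d != 0 ->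
  (forall i, \sum_j D i j = d) ->
  d * \det (D - const_mx w) = \det D * (d - w * n%:R).
Proof.
move=> d0 rowD.
have -> : D - const_mx w = D *m (1%:M - const_mx (w / d) *m (const_mx 1 : 'rV_n)).
  rewrite mulmxBr mulmx1 mulmxA [const_mx (w / d)]const_mxZ -scalemxAr.
  rewrite (mulmx_const1 _ rowD).
  rewrite [const_mx d]const_mxZ scalerA divfK // -scalemxAl const_mx1_mul.
  by rewrite [const_mx w]const_mxZ.
rewrite det_mulmx det_1_subC [in X in _ *m X]const_mxZ -scalemxAr const_mx1_mul.
rewrite mulrCA; congr (_ * _); rewrite det_mx11 !mxE eqxx mulr1n.
by field.
Qed.

(** Since [P] sends the constant matrix [u / p] to the constant matrix [u], a column operation
    clears the upper right block. It changes [D] by a constant matrix, which [det_sub_const]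
    handles. *)
Lemma det_join n1 n2 (P : 'M[F]_n1) (D : 'M[F]_n2) (p d u v : F) :
  p != 0 -> d != 0 ->
  (forall i, \sum_j P i j = p) -> (forall i, \sum_j D i j = d) ->
  p * d * \det (block_mx P (const_mx u) (const_mx v) D)
    = \det P * \det D * (p * d - u * v * n1%:R * n2%:R).
Proof.
move=> p0 d0 rowP rowD; set M := block_mx _ _ _ _.
have : \det (M *m block_mx 1%:M (- const_mx (u / p)) 0 1%:M) =
    \det (block_mx P 0 (const_mx v) (D - const_mx (u * v * n1%:R / p))).
  rewrite mulmx_block !mulmx1 !mulmx0 !addr0 !mulmxN.
  rewrite ![const_mx (u / p)]const_mxZ -!scalemxAr (mulmx_const1 _ rowP).
  rewrite [const_mx v]const_mxZ -scalemxAl const_mx1_mul; congr (\det (block_mx _ _ _ _)).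
    by apply/matrixP => i j; rewrite !mxE; field.
  by apply/matrixP => i j; rewrite !mxE; field.
rewrite det_mulmx det_ublock !det1 !mulr1 => ->.
rewrite det_lblock; have := det_sub_const (u * v * n1%:R / p) d0 rowD.
set x := \det (D - _) => dx; transitivity (p * \det P * (d * x)); first by ring.
by rewrite dx; field.
Qed.

(* Subtracting B^T times the vertex rows from the edge rows turns the edge
   block b I - c B^T B into the scalar matrix b I, on which one can pivot. *)
Lemma det_Qjoin n1 n2 m (B : 'M[F]_(n1, m)) (D : 'M[F]_n2) (a b c d t : F)
    (p := a - 2 * c * t * (a + c) / b) :
  b != 0 -> p != 0 -> d != 0 ->
  (forall i, \sum_e B i e = t) -> (forall e, \sum_i B i e = 2) ->
  (forall i, \sum_j D i j = d) ->
  p * d * \det (block_mx (b%:M - c *: (B^T *m B)) (row_mx (- c *: B^T) 0)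
      (col_mx (- c *: B) 0) (block_mx a%:M (const_mx (- c)) (const_mx (- c)) D))
  = b ^+ m * \det (a%:M - (a + c) / b *: (c *: (B *m B^T))) * \det D
    * (p * d - c ^+ 2 * (1 - 2 * c * t / b) * n1%:R * n2%:R).
Proof.
move=> b0 p0 d0 rowB colB rowD; set M := block_mx _ _ _ _.
have rowBT e : \sum_i B^T e i = 2.
  by rewrite -(colB e); apply: eq_bigr => i _; rewrite mxE.
pose T : 'M_(m, n1 + n2) := row_mx (- B^T) 0.
have : \det (block_mx 1%:M T 0 1%:M *m M) =
    \det (block_mx b%:M (row_mx (- (a + c) *: B^T) (const_mx (2 * c)))
       (col_mx (- c *: B) 0) (block_mx a%:M (const_mx (- c)) (const_mx (- c)) D)).
  rewrite mulmx_block !mul1mx !mul0mx !add0r; congr (\det (block_mx _ _ _ _)).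
    rewrite mul_row_col mul0mx addr0 mulNmx -scalemxAr scaleNr opprK.
    by rewrite subrK.
  rewrite mul_row_block !mul0mx !addr0 !mulNmx add_row_mx; congr (row_mx _ _).
    by rewrite mul_mx_scalar -scaleNr -scalerDl opprD addrC.
  rewrite add0r const_mxZ -scalemxAr (mulmx_const1 _ rowBT).
  by apply/matrixP => i j; rewrite !mxE; ring.
rewrite det_mulmx det_ublock !det1 !mul1r => ->.
rewrite det_block_scalar // mul_col_row !mul0mx scale_block_mx.
rewrite opp_block_mx add_block_mx !scaler0 !subr0.
have -> : a%:M - b^-1 *: (- c *: B *m (- (a + c) *: B^T))
    = a%:M - (a + c) / b *: (c *: (B *m B^T)).
  congr (_ - _); rewrite -scalemxAl -scalemxAr !scalerA; congr (_ *: _).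
  by field.
(* The row operation has filled the edge-[D] corner with [2 * c], as every edge has two ends.
   Pivoting moves this to the vertex rows through the row sums [t] of [B]. *)
have -> : const_mx (- c) - b^-1 *: (- c *: B *m const_mx (2 * c))
    = const_mx (- c * (1 - 2 * c * t / b)) :> 'M_(n1, n2).
  rewrite [const_mx (2 * c)]const_mxZ -scalemxAl -scalemxAr (mulmx_const1 _ rowB).
  by apply/matrixP => i j; rewrite !mxE; field.
set P := a%:M - _.
have rowP i : \sum_j P i j = p.
  have rowBB : \sum_j (B *m B^T) i j = 2 * t.
    under eq_bigr do rewrite mxE.
    rewrite exchange_big /= -(rowB i) mulr_sumr; apply: eq_bigr => e _.
    by rewrite -mulr_sumr rowBT mulrC.
  under eq_bigr do rewrite !mxE; rewrite sumrB.
  rewrite (bigD1 i) //= eqxx big1 => [|j ji]; last by rewrite eq_sym (negPf ji).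
  rewrite -!mulr_sumr; have := rowBB; under eq_bigr do rewrite mxE.
  by move=> ->; rewrite /p mulr1n; field.
rewrite mulrCA (det_join _ _ p0 d0 rowP rowD) -!mulrA.
by congr (_ * (_ * (_ * (_ - _)))); field.
Qed.

End Determinants.

(** For [r != 0] this is the characteristic polynomial at [s / r], rescaled. The case [r = 0] is
    separate; it occurs because the coefficient [(a + c) / b] may vanish. *)
Lemma det_scalar_sub (R : rcfType) n (A : 'M[R]_n) (s r : R) : A^T = A ->
  \det (s%:M - r *: A) = \prod_(x <- spectrum A) (s - r * x).
Proof.
move=> symA; have [->|r0] := eqVneq r 0.
  rewrite scale0r subr0 det_scalar -{1}(size_spectrum symA).
  under eq_bigr do rewrite mul0r subr0.
  by rewrite big_const_seq count_predT iter_mulr mulr1.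
have -> : s%:M - r *: A = r *: ((s / r)%:M - A).
  by rewrite scalerBr scale_scalar_mx mulrCA divff // mulr1.
rewrite detZ -horner_char_poly -prod_spectrum // horner_prod.
rewrite -{1}(size_spectrum symA) -[r ^+ _]mulr1 -iter_mulr.
rewrite -count_predT -big_const_seq -big_split; apply: eq_bigr => x _ /=.
by rewrite hornerXsubC; field.
Qed.

(** * Counting vertex-edge incidences *)

Section Incidence.
Variable G : sgraph.
Implicit Types (x y : G) (e f : edge G).

Lemma mem_edges x y : ([set x; y] \in edges G) = adj x y.
Proof.
apply/imsetP/idP => [[[u v]] | xy]; last by exists (x, y); rewrite ?inE.
rewrite inE /= => uv eq_xy.
have /set2P u_xy : u \in [set x; y] by rewrite eq_xy set21.
have /set2P v_xy : v \in [set x; y] by rewrite eq_xy set22.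
by case: u_xy v_xy uv => -> [] ->; rewrite ?adj_irrefl // adj_sym.
Qed.

Lemma card_edge e : #|val e| = 2.
Proof.
case: e => _ /= /imsetP[[u v] + ->]; rewrite inE /= => uv; rewrite cards2.
by have -> : u != v by apply: contraTneq uv => ->; rewrite adj_irrefl.
Qed.

Lemma deg_sum x : deg x = (\sum_y adj x y)%N.
Proof. by rewrite /deg cardsE -sum1_card big_mkcond. Qed.

Lemma sum_mem_edge e : (\sum_x (x \in val e))%N = 2.
Proof. by rewrite -(card_edge e) -sum1_card [RHS]big_mkcond. Qed.

(** An edge has two elements, so the only one that can contain both [x] and [y] is [[set x; y]]. *)
Lemma sum_edges_neq x y : x != y ->
  (\sum_(e : edge G) ((x \in val e) && (y \in val e)))%N = adj x y.
Proof.
move=> xNy; have in_e (e : edge G) :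
    (x \in val e) && (y \in val e) = (val e == [set x; y]).
  rewrite eq_sym eqEcard card_edge cards2 xNy andbT subUset !sub1set.
  by [].
under eq_bigr do rewrite in_e; rewrite -mem_edges.
case: (boolP ([set x; y] \in edges G)) => xy.
  rewrite (bigD1 (Sub [set x; y] xy : edge G)) //= eqxx big1 // => e.
  by rewrite -val_eqE /= => /negPf ->.
by rewrite big1 // => e _; case: eqP => // ve; rewrite -ve (valP e) in xy.
Qed.

(* An edge through x has exactly one other end, so the edges through x can be
   counted over the vertices y != x. *)
Lemma sum_edges_at x : (\sum_(e : edge G) (x \in val e))%N = deg x.
Proof.
have other (e : edge G) : ((x \in val e) : nat) =
    (\sum_(y | y != x) ((x \in val e) && (y \in val e)))%N.
  have := sum_mem_edge e; rewrite (bigD1 x) //=; case: (x \in val e) => /=.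
    by rewrite addnC addn1 => -[->].
  by move=> _; rewrite big1.
under eq_bigr do rewrite other.
rewrite exchange_big /= deg_sum [RHS](bigD1 x) //= adj_irrefl add0n.
by apply: eq_bigr => y yNx; rewrite sum_edges_neq // eq_sym.
Qed.

Lemma handshake t : regular G t -> (2 * gsize G = t * gorder G)%N.
Proof.
move=> Greg; transitivity (\sum_(e : edge G) \sum_x (x \in val e))%N.
  under eq_bigr do rewrite sum_mem_edge.
  by rewrite sum_nat_const card_sig mulnC.
rewrite exchange_big /=; under eq_bigr do rewrite sum_edges_at Greg.
by rewrite sum_nat_const mulnC.
Qed.

(** Distinct edges share at most one vertex, so their number of common vertices is the truth value
    of adjacency in the Q-graph. *)
Lemma sum_mem2_edge e f :
  (\sum_x ((x \in val e) && (x \in val f)) = 2 * (e == f) + Qadj (inr e) (inr f))%N.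
Proof.
have -> : (\sum_x ((x \in val e) && (x \in val f)) = #|val e :&: val f|)%N.
  rewrite -sum1_card [RHS]big_mkcond; apply: eq_bigr => x _.
  by rewrite inE; case: (_ && _).
have [->|eNf] /= := eqVneq e f; first by rewrite setIid card_edge eqxx.
have : (#|val e :&: val f| < 2)%N.
  rewrite -[ltnRHS](card_edge e) proper_card // properE subsetIl /=.
  apply: contra eNf; rewrite subsetI subxx /= => ef.
  by rewrite -val_eqE eqEcard ef !card_edge.
by rewrite /= eNf -cards_eq0 muln0; case: #|_| => [|[]].
Qed.

End Incidence.

(** * Vertex degrees in the Q-vertex join *)

Section JoinDegrees.
Variables (G1 G2 : sgraph) (t1 t2 : nat).
Hypotheses (G1reg : regular G1 t1) (G2reg : regular G2 t2).
Local Notation H := (Qvertex_join G1 G2).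

Lemma deg_join_orig (x : G1) : deg (inl (inl x) : H) = (t1 + gorder G2)%N.
Proof.
rewrite deg_sum !big_sumType /= big1 // add0n sum_edges_at G1reg; congr (_ + _)%N.
by rewrite sum_nat_const muln1.
Qed.

(** Counting pairs of an edge [f] and a vertex [x] common to [e] and [f] gives [2 * t1]. The term
    [f = e] contributes 2, which matches the two ends of [e] among its neighbours. *)
Lemma deg_join_edge (e : edge G1) : deg (inl (inr e) : H) = (2 * t1)%N.
Proof.
rewrite deg_sum !big_sumType /= [X in (_ + X)%N]big1 // addn0 sum_mem_edge.
have : (\sum_(f : edge G1) \sum_x ((x \in val e) && (x \in val f)) = 2 * t1)%N.
  rewrite exchange_big /=.
  under eq_bigr => x _.
    under eq_bigr do rewrite -mulnb.
    rewrite -big_distrr /= sum_edges_at G1reg; over.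
  by rewrite -big_distrl /= sum_mem_edge.
under eq_bigr do rewrite sum_mem2_edge.
rewrite big_split /= -big_distrr /= (bigD1 e) //= eqxx big1 //.
by move=> f; rewrite eq_sym => /negPf ->.
Qed.

Lemma deg_join_right (y : G2) : deg (inr y : H) = (gorder G1 + t2)%N.
Proof.
rewrite deg_sum !big_sumType /= [X in (_ + X + _)%N]big1 // addn0.
by rewrite -deg_sum G2reg sum_nat_const muln1.
Qed.

End JoinDegrees.

(** * Change of enumeration in determinants and sums *)

Lemma det_reindex (R : comNzRingType) (T : finType) (f : T -> T -> R) n
    (h : 'I_n -> T) : bijective h ->
  \det (\matrix_(i < #|T|, j < #|T|) f (enum_val i) (enum_val j))
  = \det (\matrix_(i, j) f (h i) (h j)).
Proof.
move=> bij_h; have nT : n = #|T| by rewrite -(card_ord n) (bij_eq_card bij_h).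
subst n; have inj_s : injective (enum_rank \o h).
  exact: inj_comp enum_rank_inj (bij_inj bij_h).
set M := \matrix_(i, j) _; pose s := perm inj_s.
(* Rows and columns undergo the same permutation, so the two signs cancel. *)
have -> : \matrix_(i, j) f (h i) (h j) = row_perm s (col_perm s M).
  by apply/matrixP => i j; rewrite !mxE !permE /= !enum_rankK.
rewrite row_permE col_permE !det_mulmx !det_perm odd_permV.
by rewrite mulrCA -signr_addb addbb mulr1.
Qed.

Lemma sum_enum_val (R : nmodType) (T : finType) (F : T -> R) :
  \sum_(i < #|T|) F (enum_val i) = \sum_x F x.
Proof.
rewrite [RHS](reindex (@enum_val _ predT)) //=; apply: onW_bij.
exact: enum_val_bij.
Qed.

(** * Entries and row sums of the matrix [Aalpha] *)

Section AalphaMatrix.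
Variables (R : rcfType) (alpha : R) (G : sgraph).

Lemma AalphaE i j : Aalpha G alpha i j
  = alpha * (deg (enum_val i))%:R *+ (i == j)
    + (1 - alpha) * (adj (enum_val i) (enum_val j))%:R.
Proof. by rewrite !mxE -mulrnAr. Qed.

Lemma tr_Aalpha : (Aalpha G alpha)^T = Aalpha G alpha.
Proof.
apply/matrixP => i j; rewrite mxE !AalphaE [adj (enum_val j) _]adj_sym.
by have [->|] := eqVneq i j; rewrite ?mulr0n // eq_sym.
Qed.

Lemma Aalpha_ge0 i j : 0 <= alpha <= 1 -> 0 <= Aalpha G alpha i j.
Proof.
move=> /andP[a0 a1]; rewrite AalphaE addr_ge0 ?mulrn_wge0 //.
  by rewrite mulr_ge0 ?ler0n.
by rewrite mulr_ge0 ?ler0n ?subr_ge0.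
Qed.

Lemma Aalpha_rowsum t i : regular G t -> \sum_j Aalpha G alpha i j = t%:R.
Proof.
move=> Greg; under eq_bigr do rewrite AalphaE.
rewrite big_split /= -mulr_sumr (bigD1 i) //= eqxx mulr1n big1 => [|j]; last first.
  by rewrite eq_sym => /negPf ->.
have -> : \sum_(j < gorder G) (adj (enum_val i) (enum_val j))%:R = t%:R :> R.
  rewrite -(Greg (enum_val i)) deg_sum natr_sum.
  exact: (sum_enum_val (fun y : G => (adj (enum_val i) y)%:R : R)).
by rewrite Greg; ring.
Qed.

End AalphaMatrix.

(** * The incidence matrix and its two Gram matrices *)

Section IncidenceMatrix.
Variables (R : rcfType) (G : sgraph).

Definition incidence_mx : 'M[R]_(gorder G, #|{: edge G}|) :=
  \matrix_(i < gorder G, e < #|{: edge G}|) (enum_val i \in val (enum_val e))%:R.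

Lemma incidence_rowsum t i : regular G t ->
  \sum_e incidence_mx i e = t%:R.
Proof.
move=> Greg; under eq_bigr do rewrite mxE.
rewrite (sum_enum_val (fun e : edge G => (enum_val i \in val e)%:R : R)).
by rewrite -natr_sum sum_edges_at Greg.
Qed.

Lemma incidence_colsum e : \sum_i incidence_mx i e = 2.
Proof.
under eq_bigr do rewrite mxE.
rewrite (sum_enum_val (fun x : G => (x \in val (enum_val e))%:R : R)).
by rewrite -natr_sum sum_mem_edge.
Qed.

Lemma incidence_tr_mulE e f : (incidence_mx^T *m incidence_mx) e f
  = 2 *+ (e == f) + (Qadj (inr (enum_val e)) (inr (enum_val f)))%:R.
Proof.
rewrite mxE; under eq_bigr do rewrite !mxE -natrM mulnb.
rewrite (sum_enum_val (fun x : G =>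
  ((x \in val (enum_val e)) && (x \in val (enum_val f)))%:R : R)).
rewrite -natr_sum sum_mem2_edge natrD (inj_eq enum_val_inj).
by rewrite natrM mulr_natr.
Qed.

(** Off the diagonal both sides count the edge joining two vertices. On it, [(1 - alpha) * t = alpha
    * t + t * (1 - 2 * alpha)]. *)
Lemma incidence_mul_tr alpha t : regular G t ->
  (1 - alpha) *: (incidence_mx *m incidence_mx^T)
  = Aalpha G alpha + (t%:R * (1 - 2 * alpha))%:M.
Proof.
move=> Greg; apply/matrixP => i j; rewrite mxE [RHS]mxE AalphaE Greg !mxE.
under eq_bigr do rewrite !mxE -natrM mulnb.
rewrite (sum_enum_val (fun e : edge G =>
  ((enum_val i \in val e) && (enum_val j \in val e))%:R : R)) -natr_sum.
have [->|iNj] := eqVneq i j.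
  under eq_bigr do rewrite andbb.
  by rewrite sum_edges_at Greg adj_irrefl /= !mulr1n; ring.
by rewrite sum_edges_neq ?(inj_eq enum_val_inj) // !mulr0n; ring.
Qed.

End IncidenceMatrix.

(** * Block form of the matrix of the join *)

Section JoinDeterminant.
Variables (R : rcfType) (alpha : R) (G1 G2 : sgraph) (t1 t2 : nat).
Hypotheses (G1reg : regular G1 t1) (G2reg : regular G2 t2).
Local Notation H := (Qvertex_join G1 G2).
Local Notation m := #|{: edge G1}|.
Local Notation n1 := (gorder G1).
Local Notation n2 := (gorder G2).
Local Notation B := (incidence_mx R G1).

(** Edges come first, so that the block to pivot on is the upper left one. *)
Definition join_enum (k : 'I_(m + (n1 + n2))) : H :=
  match split k with
  | inl e => inl (inr (enum_val e))
  | inr k' => match split k' with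
    | inl i => inl (inl (enum_val i))
    | inr j => inr (enum_val j)
    end
  end.

Lemma join_enum_edge e : join_enum (lshift _ e) = inl (inr (enum_val e)).
Proof. by rewrite /join_enum (unsplitK (inl e)). Qed.

Lemma join_enum_orig i :
  join_enum (rshift _ (lshift _ i)) = inl (inl (enum_val i)).
Proof. by rewrite /join_enum (unsplitK (inr _)) (unsplitK (inl i)). Qed.

Lemma join_enum_right j : join_enum (rshift _ (rshift _ j)) = inr (enum_val j).
Proof. by rewrite /join_enum (unsplitK (inr _)) (unsplitK (inr j)). Qed.

Definition join_enumE := (join_enum_edge, join_enum_orig, join_enum_right).

Lemma join_enum_bij : bijective join_enum.
Proof.
apply: inj_card_bij; last by rewrite !card_sum card_ord addnA [(n1 + m)%N]addnC.
move=> k l; case: (split_ordP k) => [e ->|k' ->];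
  [|case: (split_ordP k') => [i ->|j ->]];
  case: (split_ordP l) => [f ->|l' ->];
  try (case: (split_ordP l') => [i' ->|j' ->]);
  by rewrite !join_enumE => // -[/enum_val_inj ->].
Qed.

(** The summand [2 * c] of [b] compensates the diagonal entries 2 of [B^T *m B], since an edge is
    not adjacent to itself in the Q-graph. *)
Lemma det_join_blocks (x : R) (c := 1 - alpha)
    (a := x - alpha * (t1%:R + n2%:R)) (b := x - 2 * alpha * t1%:R + 2 * c) :
  \det (x%:M - Aalpha H alpha)
  = \det (block_mx (b%:M - c *: (B^T *m B)) (row_mx (- c *: B^T) 0)
      (col_mx (- c *: B) 0) (block_mx a%:M (const_mx (- c)) (const_mx (- c))
        ((x - alpha * n1%:R)%:M - Aalpha G2 alpha))).
Proof.
pose f (u v : H) : R := x *+ (u == v)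
  - (alpha * (deg u)%:R *+ (u == v) + c * (adj u v)%:R).
have -> : x%:M - Aalpha H alpha
    = \matrix_(i < #|H|, j < #|H|) f (enum_val i) (enum_val j).
  by apply/matrixP => i j; rewrite mxE [in LHS]mxE mxE AalphaE mxE
    /f (inj_eq enum_val_inj).
rewrite (det_reindex f join_enum_bij); congr (\det _).
apply/matrixP => k l; rewrite mxE.
case: (split_ordP k) => [e ->|k' ->];
  [|case: (split_ordP k') => [i ->|j ->]];
  case: (split_ordP l) => [e' ->|l' ->];
  try (case: (split_ordP l') => [i' ->|j' ->]);
  rewrite !join_enumE ?(block_mxEul, block_mxEur, block_mxEdl, block_mxEdr)
    ?(row_mxEl, row_mxEr, col_mxEu, col_mxEd)
    ?(block_mxEul, block_mxEur, block_mxEdl, block_mxEdr) /f.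
all: rewrite ?(deg_join_orig _ G1reg, deg_join_edge _ G1reg,
  deg_join_right _ G2reg).
- rewrite [RHS]mxE [in RHS]mxE [X in _ = _ + X]mxE [X in _ = _ + - X]mxE.
  rewrite incidence_tr_mulE.
  have -> : (inl (inr (enum_val e)) == inl (inr (enum_val e')) :> H) = (e == e').
    by rewrite -(inj_eq enum_val_inj).
  by case: (e == e'); rewrite ?mulr1n ?mulr0n /= /b /c; ring.
- by rewrite !mxE /= /c; ring.
- by rewrite !mxE /=; ring.
- by rewrite !mxE /= /c; ring.
- have -> : (inl (inl (enum_val i)) == inl (inl (enum_val i')) :> H) = (i == i').
    by rewrite -(inj_eq enum_val_inj).
  by rewrite mxE /=; case: (i == i'); rewrite ?mulr1n ?mulr0n /= /a; ring.
- by rewrite !mxE /= /c; ring.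
- by rewrite !mxE /=; ring.
- by rewrite !mxE /= /c; ring.
- have -> : (inr (enum_val j) == inr (enum_val j') :> H) = (j == j').
    by rewrite -(inj_eq enum_val_inj).
  rewrite [RHS]mxE [in RHS]mxE [X in _ = _ + X]mxE AalphaE G2reg.
  by case: (j == j'); rewrite ?mulr1n ?mulr0n /= /c; ring.
Qed.

End JoinDeterminant.

(** * The characteristic polynomial of the join *)

Section JoinCharPoly.
Variable R : rcfType.

Lemma prodr_scale (s : seq R) (b : R) (f : R -> R) :
  b ^+ size s * \prod_(y <- s) f y = \prod_(y <- s) (b * f y).
Proof.
by rewrite big_split big_const_seq count_predT iter_mulr mulr1.
Qed.

Definition join_quadratic (alpha : R) (t1 n2 : nat) (l : R) : {poly R} :=
  'X ^+ 2 - (t1%:R - 2 + l%:P + alpha%:P * (2 + t1%:R + n2%:R)) * 'X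
  - 2 * alpha%:P * (1 - alpha%:P) * n2%:R
  - (1 - alpha%:P * (1 + t1%:R + n2%:R)) * (t1%:R + l%:P).

Definition join_cubic (alpha : R) (t1 n1 t2 n2 : nat) : {poly R} :=
  ('X - alpha%:P * n1%:R - t2%:R) * ('X - alpha%:P * t1%:R - alpha%:P * n2%:R)
    * ('X + 2 - 2 * alpha%:P - 2 * t1%:R)
  - n1%:R * n2%:R * (1 - alpha%:P) ^+ 2 * ('X + 2 - 2 * alpha%:P - 2 * t1%:R)
  - 2 * (1 - alpha%:P) ^+ 2 * t1%:R * ('X - alpha%:P * n1%:R - t2%:R).

Lemma horner_natr (k : nat) (x : R) : (k%:R : {poly R}).[x] = k%:R.
Proof. by rewrite hornerMn hornerC. Qed.

(** As [l + t1%:R * (1 - 2 * alpha)] is the eigenvalue of [c *: (B *m B^T)] belonging to [l], the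
    value is [b] times an eigenvalue of the vertex block left after pivoting. *)
Lemma horner_join_quadratic alpha t1 n2 l x (c := 1 - alpha)
    (a := x - alpha * (t1%:R + n2%:R)) (b := x - 2 * alpha * t1%:R + 2 * c) :
  (join_quadratic alpha t1 n2 l).[x]
  = a * b - (a + c) * (l + t1%:R * (1 - 2 * alpha)).
Proof.
rewrite /join_quadratic /a /b /c !(hornerE, horner_natr) /=.
by ring.
Qed.

Lemma join_cubicE alpha t1 n1 t2 n2
    (u := alpha * n1%:R + t2%:R) (v := alpha * (t1%:R + n2%:R))
    (w := 2 * alpha - 2 + 2 * t1%:R) :
  join_cubic alpha t1 n1 t2 n2 = ('X - u%:P) * ('X - v%:P) * ('X - w%:P)
    - ((n1%:R * n2%:R * (1 - alpha) ^+ 2) *: ('X - w%:P)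
       + (2 * (1 - alpha) ^+ 2 * t1%:R) *: ('X - u%:P)).
Proof. by rewrite /join_cubic /u /v /w -!mul_polyC; ring. Qed.

Lemma horner_join_cubic alpha t1 n1 t2 n2 x (c := 1 - alpha)
    (d := x - (alpha * n1%:R + t2%:R)) (a := x - alpha * (t1%:R + n2%:R))
    (w := x - (2 * alpha - 2 + 2 * t1%:R)) :
  (join_cubic alpha t1 n1 t2 n2).[x]
  = d * a * w - (n1%:R * n2%:R * c ^+ 2 * w + 2 * c ^+ 2 * t1%:R * d).
Proof. by rewrite join_cubicE !(hornerE, hornerXsubC) /=. Qed.

(** The subtracted combination has degree at most 1 and leaves the leading term alone. *)
Lemma cubic_monic (u v w e f : R)
    (p := ('X - u%:P) * ('X - v%:P) * ('X - w%:P)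
          - (e *: ('X - w%:P) + f *: ('X - u%:P))) :
  p \is monic /\ size p = 4.
Proof.
pose q : {poly R} := \prod_(y <- [:: u; v; w]) ('X - y%:P).
have mq : q \is monic by apply: monic_prod_XsubC.
have sq : size q = 4 by rewrite size_prod_XsubC.
have qE : ('X - u%:P) * ('X - v%:P) * ('X - w%:P) = q.
  by rewrite /q !big_cons big_nil mulr1 mulrA.
have st : (size (- (e *: ('X - w%:P) + f *: ('X - u%:P))) < size q)%N.
  rewrite sq size_polyN (leq_ltn_trans (size_polyD _ _)) // ltnS geq_max.
  by rewrite !(leq_trans (size_scale_leq _ _)) ?size_XsubC.
by rewrite /p qE size_polyDl // monicE lead_coefDl // -monicE.
Qed.

(** The power [z ^+ n1] stays on the left because [m1 - n1] can be negative, as for K_2. The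
    eigenvalues [t1] and [t2], whose eigenvectors are constant, merge into the cubic. *)
Lemma join_char_poly (alpha : R) (G1 G2 : sgraph) (t1 t2 : nat)
    (n1 := gorder G1) (n2 := gorder G2) (s1 s2 : seq R)
    (z : {poly R} := ('X - (2 * alpha * (1 + t1%:R) - 2)%:P)) :
  regular G1 t1 -> regular G2 t2 ->
  spectrum (Aalpha G1 alpha) = t1%:R :: s1 ->
  spectrum (Aalpha G2 alpha) = t2%:R :: s2 ->
  z ^+ n1 * char_poly (Aalpha (Qvertex_join G1 G2) alpha)
  = z ^+ gsize G1 * \prod_(l <- s2) ('X - (alpha * n1%:R + l)%:P)
    * \prod_(l <- s1) join_quadratic alpha t1 n2 l
    * join_cubic alpha t1 n1 t2 n2.
Proof.
move=> G1reg G2reg spec1 spec2.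
pose c := 1 - alpha.
pose w := 2 * alpha - 2 + 2 * t1%:R.
(* The factors of [g] take the values [b], [d] and [b * p], the quantities that must be nonzero in
   [det_Qjoin]. *)
pose g : {poly R} := z * (('X - (alpha * n1%:R + t2%:R)%:P)
  * (('X - (alpha * (t1%:R + n2%:R))%:P) * ('X - w%:P) - (2 * c ^+ 2 * t1%:R)%:P)).
have [mq sq] := cubic_monic (alpha * n1%:R + t2%:R) (alpha * (t1%:R + n2%:R)) w
   0 (2 * c ^+ 2 * t1%:R).
have g0 : g != 0.
  rewrite mulf_neq0 ?polyXsubC_eq0 //.
  have /monic_neq0 := mq; congr (_ != _); rewrite -!mul_polyC; ring.
apply: (poly_eq_generic g0) => x.
set b := x - 2 * alpha * t1%:R + 2 * c; set a := x - alpha * (t1%:R + n2%:R).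
set d := x - (alpha * n1%:R + t2%:R).
have zx : z.[x] = b by rewrite hornerXsubC /b /c; ring.
have -> : g.[x] = b * (d * (a * (x - w) - 2 * c ^+ 2 * t1%:R)).
  rewrite /g hornerM zx hornerM hornerXsubC hornerD hornerN.
  by rewrite hornerC hornerM !hornerXsubC.
rewrite !mulf_eq0 !negb_or => /andP[b0 /andP[d0 p0]].
rewrite !hornerM !horner_exp !horner_prod zx horner_join_cubic -/a -/d.
pose p := a - 2 * c * t1%:R * (a + c) / b.
have pE : b * p = a * (x - w) - 2 * c ^+ 2 * t1%:R.
  rewrite /p mulrBr [b * (_ / b)]mulrC divfK // /b /w /c; ring.
have {}p0 : p != 0 by apply: contraNneq p0 => p0; rewrite -pE p0 mulr0.
rewrite horner_char_poly (det_join_blocks _ G1reg G2reg) -/c -/a -/b.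
set D := (x - alpha * n1%:R)%:M - _.
have rowD i : \sum_j D i j = d.
  under eq_bigr do rewrite mxE [X in _ + X]mxE mxE.
  rewrite sumrB (Aalpha_rowsum _ _ G2reg) (bigD1 i) //= eqxx big1 => [|j].
    by rewrite mulr1n addr0 /d opprD addrA.
  by rewrite eq_sym => /negPf ->.
have detD : \det D = d * \prod_(l <- s2) (x - (alpha * n1%:R + l)).
  rewrite /D -[Aalpha G2 alpha]scale1r det_scalar_sub ?tr_Aalpha // spec2.
  rewrite big_cons mul1r /d opprD addrA; congr (_ * _).
  by apply: eq_bigr => l _; rewrite mul1r opprD addrA.
have := det_Qjoin b0 p0 d0 (fun i => incidence_rowsum R i G1reg)
  (fun e => incidence_colsum R e) rowD.
set N := \det (block_mx _ _ _ _); set P := a%:M - _.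
set quads := \prod_(l <- s1) _; set s2prod := \prod_(l <- s2) _.
(* One factor [b] goes to each of the [n1] eigenvalues: [t1] yields [b * p], the others the
   quadratics. *)
have detP : b ^+ n1 * \det P = b * p * quads.
  rewrite /P (incidence_mul_tr _ G1reg) scalerDr scale_scalar_mx opprD addrCA addrC.
  rewrite -raddfB det_scalar_sub ?tr_Aalpha //.
  rewrite -{1}[n1](size_spectrum (tr_Aalpha alpha G1)) prodr_scale spec1 big_cons.
  congr (_ * _); first by rewrite /p /c; field.
  apply: eq_bigr => l _; rewrite horner_join_quadratic -/c -/a -/b.
  by rewrite /c; field.
have -> : s2prod = \prod_(l <- s2) (x - (alpha * n1%:R + l)).
  by apply: eq_bigr => l _; rewrite hornerXsubC.
move=> key; apply: (mulfI (mulf_neq0 p0 d0)).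
rewrite mulrCA key !mulrA [b ^+ n1 * _]mulrC -[_ * b ^+ n1 * _]mulrA detP detD.
rewrite card_sig.
have -> : d * a * (x - w) = b * p * d + 2 * c ^+ 2 * t1%:R * d by rewrite pE; ring.
have -> : x - w = b - 2 * c * t1%:R by rewrite /w /b /c; ring.
rewrite -[#|_|]/(gsize G1).
rewrite -/p; set k1 := (gorder G1)%:R; set k2 := (gorder G2)%:R.
(* The factor [b] accompanying [p] in [detP] clears the last denominator; the result is the value of
   the cubic. *)
have factor_b : b * (p * d - c ^+ 2 * (1 - 2 * c * t1%:R / b) * k1 * k2)
    = b * p * d - k1 * k2 * c ^+ 2 * (b - 2 * c * t1%:R).
  have -> : 2 * c * t1%:R / b = 1 - (b - 2 * c * t1%:R) / b.
    by rewrite mulrBl divff // opprB addrC subrK.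
  rewrite subKr; set r := b - _.
  by rewrite -[in RHS](divfK b0 r); ring.
move: (b ^+ gsize G1) (\prod_(l <- s2) _) => bm S.
transitivity (p * d * bm * S * quads
  * (b * (p * d - c ^+ 2 * (1 - 2 * c * t1%:R / b) * k1 * k2))); first by ring.
by rewrite factor_b; ring.
Qed.

End JoinCharPoly.

(** * From factored characteristic polynomials to spectra *)

Lemma perm_spectrum_factors (R : rcfType) n (M : 'M[R]_n) k (y : R) (s r : seq R)
    (q : R -> {poly R}) (p : {poly R}) :
  char_poly M = ('X - y%:P) ^+ k * \prod_(x <- s) ('X - x%:P)
                * \prod_(l <- r) q l * p ->
  perm_eq (spectrum M)
    (nseq k y ++ s ++ flatten [seq mroots (q l) | l <- r] ++ mroots p).
Proof.
move=> chiM; have nz : char_poly M != 0 by rewrite monic_neq0 ?char_poly_monic.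
rewrite /spectrum perm_sort; move: nz; rewrite chiM => nz.
rewrite !catA; apply: perm_trans (mrootsM nz) _; rewrite perm_cat2r.
move: nz; rewrite mulf_eq0 negb_or => /andP[nz _].
apply: perm_trans (mrootsM nz) _; apply: perm_cat; last first.
  by apply: mroots_prod; move: nz; rewrite mulf_eq0 negb_or => /andP[].
rewrite (_ : _ * _ = \prod_(x <- nseq k y ++ s) ('X - x%:P)) ?mroots_prod_XsubC //.
by rewrite big_cat big_nseq iter_mulr mulr1.
Qed.

(** [mroots] sees only roots in [R]; a factor of a split polynomial has all its roots there. *)
Lemma size_mroots_factor (R : rcfType) n (M : 'M[R]_n) (p q : {poly R}) :
  M^T = M -> char_poly M = q * p -> p \is monic ->
  size (mroots p) = (size p).-1.
Proof.
move=> symM chiM mp; apply: (size_mroots_split (s := spectrum M) mp).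
by rewrite prod_spectrum // chiM dvdp_mull.
Qed.

Lemma join_cubic_monic (R : rcfType) (alpha : R) t1 n1 t2 n2 :
  join_cubic alpha t1 n1 t2 n2 \is monic /\ size (join_cubic alpha t1 n1 t2 n2) = 4.
Proof. by rewrite join_cubicE; apply: cubic_monic. Qed.

Lemma spectrum_Aalpha (R : rcfType) (alpha : R) (G : sgraph) t :
  0 <= alpha <= 1 -> (0 < gorder G)%N -> regular G t ->
  spectrum (Aalpha G alpha)
  = t%:R :: [seq eigval j (Aalpha G alpha) | j <- index_iota 2 (gorder G).+1].
Proof.
move=> alpha01 G0 Greg; apply: spectrum_rowsum => //.
- exact: tr_Aalpha.
- by move=> i j; apply: Aalpha_ge0.
- by move=> i; apply: Aalpha_rowsum.
Qed.

(* The second eigenvalue is read off the trace 2 alpha. *)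
Lemma spectrum_Aalpha_K2 (R : rcfType) (alpha : R) (G : sgraph) :
  0 <= alpha <= 1 -> gorder G = 2 -> regular G 1 ->
  spectrum (Aalpha G alpha) = [:: 1; 2 * alpha - 1].
Proof.
move=> alpha01 G2 Greg; have symA := tr_Aalpha alpha G.
have specA : spectrum (Aalpha G alpha) = [:: 1; eigval 2 (Aalpha G alpha)].
  rewrite (spectrum_Aalpha alpha01 _ Greg); last by rewrite G2.
  by rewrite [X in index_iota _ X.+1]G2.
rewrite specA; congr [:: _; _]; set l := eigval _ _.
have : (char_poly (Aalpha G alpha))`_1 = - \tr (Aalpha G alpha).
  by rewrite -char_poly_trace ?[X in _`_X.-1]G2 // G2.
have -> : \tr (Aalpha G alpha) = 2 * alpha.
  rewrite /mxtrace; under eq_bigr do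
    rewrite AalphaE Greg adj_irrefl eqxx mulr1n mulr1 mulr0 addr0.
  by rewrite sumr_const card_ord G2 mulr_natl.
rewrite -prod_spectrum // specA -/l big_cons big_seq1.
rewrite mulrBl coefB coefXM coefCM !coefB !coefX !coefC /=.
by lra.
Qed.

Theorem corollary3p1 (R : rcfType) (alpha : R) (G1 G2 : sgraph)
    (t1 n1 m1 t2 n2 : nat)
    (alpha01 : 0 <= alpha <= 1)
    (n1_gt0 : (0 < n1)%N) (n2_gt0 : (0 < n2)%N)
    (G1reg : regular G1 t1) (G1order : gorder G1 = n1) (G1size : gsize G1 = m1)
    (G2reg : regular G2 t2) (G2order : gorder G2 = n2) :
  let a : {poly R} := alpha%:P in
  let nu : {poly R} := 'X in
  (* (a), whose formulas take n1 = 2, i.e. G1 = K_2 *)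
  (t1 = 1%N -> n1 = 2%N ->
    let cubic : {poly R} :=
      (nu - 2 * a - t2%:R) * (nu - a - a * n2%:R) * (nu - 2 * a)
      - 2 * n2%:R * (1 - a) ^+ 2 * (nu - 2 * a)
      - 2 * (1 - a) ^+ 2 * (nu - 2 * a - t2%:R) in
    size (mroots cubic) = 3%N /\
    perm_eq (spectrum (Aalpha (Qvertex_join G1 G2) alpha))
      ([:: alpha * (1 + n2%:R)]
       ++ [seq 2 * alpha + eigval j (Aalpha G2 alpha)
          | j <- index_iota 2 n2.+1]
       ++ mroots cubic))
  /\
  (* (b) *)
  ((2 <= t1)%N ->
    let quadratic (i : nat) : {poly R} :=
      let l : {poly R} := (eigval i (Aalpha G1 alpha))%:P in
      nu ^+ 2 - (t1%:R - 2 + l + a * (2 + t1%:R + n2%:R)) * nu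
      - 2 * a * (1 - a) * n2%:R
      - (1 - a * (1 + t1%:R + n2%:R)) * (t1%:R + l) in
    let cubic : {poly R} :=
      (nu - a * n1%:R - t2%:R) * (nu - a * t1%:R - a * n2%:R)
        * (nu + 2 - 2 * a - 2 * t1%:R)
      - n1%:R * n2%:R * (1 - a) ^+ 2 * (nu + 2 - 2 * a - 2 * t1%:R)
      - 2 * (1 - a) ^+ 2 * t1%:R * (nu - a * n1%:R - t2%:R) in
    size (mroots cubic) = 3%N /\
    perm_eq (spectrum (Aalpha (Qvertex_join G1 G2) alpha))
      (nseq (m1 - n1) (2 * alpha * (1 + t1%:R) - 2)
       ++ [seq alpha * n1%:R + eigval j (Aalpha G2 alpha)
          | j <- index_iota 2 n2.+1]
       ++ flatten [seq mroots (quadratic i) | i <- index_iota 2 n1.+1]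
       ++ mroots cubic)).
Proof.
move=> a nu; subst n1 m1 n2.
have edges2 := handshake G1reg.
have spec2 := spectrum_Aalpha alpha01 n2_gt0 G2reg.
have symH := tr_Aalpha alpha (Qvertex_join G1 G2).
split=> [t1_1 n1_2|t1_ge2].
  subst t1; move=> cubic.
  have defc : cubic = join_cubic alpha 1 2 t2 (gorder G2).
    by rewrite /cubic /join_cubic /a /nu; ring.
  have [mc sc] := join_cubic_monic alpha 1 2 t2 (gorder G2).
  have chiH : char_poly (Aalpha (Qvertex_join G1 G2) alpha)
      = ('X - (alpha * (1 + (gorder G2)%:R))%:P) ^+ 1
        * \prod_(x <- [seq 2 * alpha + eigval j (Aalpha G2 alpha)
                      | j <- index_iota 2 (gorder G2).+1]) ('X - x%:P)
        * \prod_(l <- [::]) join_quadratic alpha 1 (gorder G2) l * cubic.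
    have := join_char_poly G1reg G2reg (spectrum_Aalpha_K2 alpha01 n1_2 G1reg) spec2.
    (* The handshake identity reads [2 * gsize G1 = 1 * 2]. *)
    have -> : gsize G1 = 1%N by lia.
    rewrite n1_2 -defc !big_map big_seq1 big_nil mulr1.
    under eq_bigr do rewrite [alpha * 2%:R]mulrC.
    set z := 'X - _; have z0 : z ^+ 2 != 0 by rewrite expf_neq0 ?polyXsubC_eq0.
    (* At the second eigenvalue of K_2 the quadratic contains a factor [z]; with the one from the
       single edge it cancels [z ^+ 2]. *)
    have -> : join_quadratic alpha 1 (gorder G2) (2 * alpha - 1)
        = z * ('X - (alpha * (1 + (gorder G2)%:R))%:P).
      by rewrite /join_quadratic /z; ring.
    by move=> eq_chi; apply: (mulfI z0); rewrite eq_chi; ring.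
  split; last exact: perm_spectrum_factors chiH.
  by rewrite (size_mroots_factor symH chiH) defc // sc.
move=> quadratic cubic.
have spec1 := spectrum_Aalpha alpha01 n1_gt0 G1reg.
have [mc sc] := join_cubic_monic alpha t1 (gorder G1) t2 (gorder G2).
have chiH : char_poly (Aalpha (Qvertex_join G1 G2) alpha)
    = ('X - (2 * alpha * (1 + t1%:R) - 2)%:P) ^+ (gsize G1 - gorder G1)
      * \prod_(x <- [seq alpha * (gorder G1)%:R + eigval j (Aalpha G2 alpha)
                    | j <- index_iota 2 (gorder G2).+1]) ('X - x%:P)
      * \prod_(l <- [seq eigval i (Aalpha G1 alpha)
                    | i <- index_iota 2 (gorder G1).+1])
          join_quadratic alpha t1 (gorder G2) l
      * cubic.
  have := join_char_poly G1reg G2reg spec1 spec2; rewrite !big_map.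
  set z := 'X - _; have zn0 : z ^+ gorder G1 != 0.
    by rewrite expf_neq0 ?polyXsubC_eq0.
  (* By the handshake identity, twice the size is [t1] times the order and [t1 >= 2]; hence the
     truncated subtraction in the exponent is exact. *)
  have le_nm : (gorder G1 <= gsize G1)%N by nia.
  rewrite -{1}(subnKC le_nm) exprD -!mulrA => /(mulfI zn0) ->.
  by [].
split; first by rewrite (size_mroots_factor symH chiH mc) sc.
have := perm_spectrum_factors chiH.
by rewrite -map_comp.
Qed.
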